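(* Let $\bar x\in\mathbb{R}^n$ be feasible for (MPCC). For a sequence $\{(x^k,\lambda^k)\}_{k=1}^\infty\subset\mathbb{R}^n\times\mathbb{R}^\ell$, where $\lambda^k=(\lambda_g^k,\lambda_h^k,\lambda_G^k,\lambda_H^k)$, consider the conditions $$( * )\quad\begin{cases}x^k\to\bar x,\qquad \nabla_x\mathcal L^{\mathrm{cc}}(x^k,\lambda^k)\to0,\\ \{\lambda_g^k\}_{k=1}^\infty\subset\mathbb{R}^m_+,\quad \min\{-g_i(x^k),(\lambda_g^k)_i\}\to0\ \ \forall i\in[m],\\ \min\{G_i(x^k),|(\lambda_G^k)_i|\}\to0,\quad \min\{H_i(x^k),|(\lambda_H^k)_i|\}\to0\ \ \forall i\in[q].\end{cases}$$ Then the following assertions hold. (a) The point $\bar x$ is AC-stationary if and only if there exists a sequence $\{(x^k,\lambda^k)\}_{k=1}^\infty$ such that $( * )$ holds and, additionally, $$\liminf_{k\to\infty}\min\bigl\{\max\{(\lambda_G^k)_i,-(\lambda_H^k)_i\},\ \max\{-(\lambda_G^k)_i,(\lambda_H^k)_i\}\bigr\}\ge0,\quad\forall i\in[q].$$ (b) The point $\bar x$ is AM-stationary if and only if there exists a sequence $\{(x^k,\lambda^k)\}_{k=1}^\infty$ such that $( * )$ holds and, additionally, $$\liminf_{k\to\infty}\min\bigl\{\max\{(\lambda_G^k)_i,-(\lambda_H^k)_i\},\ \max\{-(\lambda_G^k)_i,(\lambda_H^k)_i\},\ \max\{(\lambda_G^k)_i,(\lambda_H^k)_i\}\bigr\}\ge0,\quad\forall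 i\in[q].$$
   Context: (MPCC): $\min_x f(x)$ s.t. $g(x)\le0$, $h(x)=0$, $0\le G(x)\perp H(x)\ge0$, with continuously differentiable $f\colon\mathbb{R}^n\to\mathbb{R}$, $g\colon\mathbb{R}^n\to\mathbb{R}^m$, $h\colon\mathbb{R}^n\to\mathbb{R}^p$, $G,H\colon\mathbb{R}^n\to\mathbb{R}^q$, $q\ge1$. Set $\ell=m+p+2q$, $[r]=\{1,\dots,r\}$, $I_{00}(\bar x)=\{i\in[q]\mid G_i(\bar x)=0,\,H_i(\bar x)=0\}$, and, for $\lambda=(\lambda_g,\lambda_h,\lambda_G,\lambda_H)\in\mathbb{R}^\ell$, $$\mathcal L^{\mathrm{cc}}(x,\lambda)=f(x)+\lambda_g^\top g(x)+\lambda_h^\top h(x)-\lambda_G^\top G(x)-\lambda_H^\top H(x).$$ A sequence $\{(x^k,\lambda^k,\delta^k,\varepsilon^k)\}_{k=1}^\infty\subset\mathbb{R}^n\times\mathbb{R}^\ell\times\mathbb{R}^\ell\times\mathbb{R}^n$ with $\lambda^k=(\lambda_g^k,\lambda_h^k,\lambda_G^k,\lambda_H^k)$, $\delta^k=(\delta_g^k,\delta_h^k,\delta_G^k,\delta_H^k)$ is approximately W-stationary w.r.t. the feasible point $\bar x$ if $(x^k,\delta^k,\varepsilon^k)\to(\bar x,0,0)$ and, for all $k\in\mathbb{N}$: - $\varepsilon^k=\nabla_x\mathcal L^{\mathrm{cc}}(x^k,\lambda^k)$; - $(\lambda_g^k)_i\ge0$, $g_i(x^k)\le(\delta_g^k)_i$,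 $(\lambda_g^k)_i(g_i(x^k)-(\delta_g^k)_i)=0$ for all $i\in[m]$; - $h(x^k)=\delta_h^k$; - $G_i(x^k)\ge-(\delta_G^k)_i$, $(\lambda_G^k)_i(G_i(x^k)+(\delta_G^k)_i)=0$ for all $i\in[q]$; - $H_i(x^k)\ge-(\delta_H^k)_i$, $(\lambda_H^k)_i(H_i(x^k)+(\delta_H^k)_i)=0$ for all $i\in[q]$; - $(G_i(x^k)+(\delta_G^k)_i)(H_i(x^k)+(\delta_H^k)_i)=0$ for all $i\in[q]$. The point $\bar x$ is AC-stationary if there is an approximately W-stationary sequence w.r.t. $\bar x$ with $(\lambda_G^k)_i(\lambda_H^k)_i\ge0$ for all $i\in I_{00}(\bar x)$ and all $k$. It is AM-stationary if there is an approximately W-stationary sequence w.r.t. $\bar x$ such that, for all $i\in I_{00}(\bar x)$ and all $k$, $\min\{(\lambda_G^k)_i,(\lambda_H^k)_i\}>0$ or $(\lambda_G^k)_i(\lambda_H^k)_i=0$. *)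

(* Defs.v *)
From HB Require Import structures.
From mathcomp Require Import all_boot all_order all_algebra.
From mathcomp Require Import all_classical all_reals all_analysis.
Import Order.TTheory GRing.Theory Num.Theory numFieldNormedType.Exports.

Set Implicit Arguments.
Unset Strict Implicit.
Unset Printing Implicit Defensive.

Local Open Scope classical_set_scope.
Local Open Scope ring_scope.

Definition dot (R : realType) (n : nat) (u v : 'rV[R]_n) : R :=
  \sum_(i < n) u 0 i * v 0 i.

(* 'D_v f x is a total operator; grad is meaningful where f is differentiable. *)
Definition grad (R : realType) (n : nat) (f : 'rV[R]_n -> R) (x : 'rV[R]_n) :
  'rV[R]_n := \row_(j < n) 'D_(delta_mx 0 j) f x.

Definition C1 (R : realType) (n : nat) (f : 'rV[R]_n -> R) : Prop :=
  (forall x, differentiable f x) /\ continuous (grad f).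

Definition C1_vec (R : realType) (n m : nat) (F : 'rV[R]_n -> 'rV[R]_m) : Prop :=
  forall i : 'I_m, C1 (fun x => F x 0 i).

Record mpcc (R : realType) (n m p q : nat) := MPCC {
  obj : 'rV[R]_n -> R;
  ineq : 'rV[R]_n -> 'rV[R]_m;
  eqc : 'rV[R]_n -> 'rV[R]_p;
  compG : 'rV[R]_n -> 'rV[R]_q;
  compH : 'rV[R]_n -> 'rV[R]_q;
  obj_C1 : C1 obj;
  ineq_C1 : C1_vec ineq;
  eqc_C1 : C1_vec eqc;
  compG_C1 : C1_vec compG;
  compH_C1 : C1_vec compH }.

(* R^(m + p + 2q), kept in its block decomposition (g, h, G, H). *)
Notation mult R m p q :=
  ('rV[R]_m * 'rV[R]_p * 'rV[R]_q * 'rV[R]_q)%type.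

Section MPCC.
Context {R : realType} {n m p q : nat}.
Implicit Types (P : mpcc R n m p q) (l : mult R m p q).

Definition pg l : 'rV[R]_m := l.1.1.1.
Definition ph l : 'rV[R]_p := l.1.1.2.
Definition pG l : 'rV[R]_q := l.1.2.
Definition pH l : 'rV[R]_q := l.2.

Definition feasible P (x : 'rV[R]_n) : Prop :=
  [/\ forall i, ineq P x 0 i <= 0,
      eqc P x = 0,
      forall i, 0 <= compG P x 0 i,
      forall i, 0 <= compH P x 0 i &
      dot (compG P x) (compH P x) = 0].

Definition I00 P (x : 'rV[R]_n) : {set 'I_q} :=
  [set i | (compG P x 0 i == 0) && (compH P x 0 i == 0)]%SET.

Definition Lcc P (x : 'rV[R]_n) l : R :=
  obj P x + dot (pg l) (ineq P x) + dot (ph l) (eqc P x)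
  - dot (pG l) (compG P x) - dot (pH l) (compH P x).

Definition grad_Lcc P (x : 'rV[R]_n) l : 'rV[R]_n :=
  grad (fun y => Lcc P y l) x.

Record approx_W_stationary P (xb : 'rV[R]_n)
    (x : nat -> 'rV[R]_n) (lam del : nat -> mult R m p q)
    (eps : nat -> 'rV[R]_n) : Prop := {
  aw_x : x k @[k --> \oo] --> xb;
  aw_del : del k @[k --> \oo] --> (0 : mult R m p q);
  aw_eps : eps k @[k --> \oo] --> (0 : 'rV[R]_n);
  aw_grad : forall k, eps k = grad_Lcc P (x k) (lam k);
  aw_g : forall k (i : 'I_m),
    [/\ 0 <= pg (lam k) 0 i,
        ineq P (x k) 0 i <= pg (del k) 0 i &
        pg (lam k) 0 i * (ineq P (x k) 0 i - pg (del k) 0 i) = 0];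
  aw_h : forall k, eqc P (x k) = ph (del k);
  aw_G : forall k (i : 'I_q),
    - pG (del k) 0 i <= compG P (x k) 0 i /\
    pG (lam k) 0 i * (compG P (x k) 0 i + pG (del k) 0 i) = 0;
  aw_H : forall k (i : 'I_q),
    - pH (del k) 0 i <= compH P (x k) 0 i /\
    pH (lam k) 0 i * (compH P (x k) 0 i + pH (del k) 0 i) = 0;
  aw_GH : forall k (i : 'I_q),
    (compG P (x k) 0 i + pG (del k) 0 i) *
    (compH P (x k) 0 i + pH (del k) 0 i) = 0 }.

Definition AC_stationary P (xb : 'rV[R]_n) : Prop :=
  exists x lam del eps, approx_W_stationary P xb x lam del eps /\
    forall i, i \in I00 P xb -> forall k,
      0 <= pG (lam k) 0 i * pH (lam k) 0 i.

Definition AM_stationary P (xb : 'rV[R]_n) : Prop :=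
  exists x lam del eps, approx_W_stationary P xb x lam del eps /\
    forall i, i \in I00 P xb -> forall k,
      0 < Num.min (pG (lam k) 0 i) (pH (lam k) 0 i) \/
      pG (lam k) 0 i * pH (lam k) 0 i = 0.

Record star_cond P (xb : 'rV[R]_n)
    (x : nat -> 'rV[R]_n) (lam : nat -> mult R m p q) : Prop := {
  st_x : x k @[k --> \oo] --> xb;
  st_grad : grad_Lcc P (x k) (lam k) @[k --> \oo] --> (0 : 'rV[R]_n);
  st_lamg : forall k (i : 'I_m), 0 <= pg (lam k) 0 i;
  st_g : forall i : 'I_m,
    Num.min (- ineq P (x k) 0 i) (pg (lam k) 0 i) @[k --> \oo] --> (0 : R);
  st_G : forall i : 'I_q,
    Num.min (compG P (x k) 0 i) `|pG (lam k) 0 i| @[k --> \oo] --> (0 : R);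
  st_H : forall i : 'I_q,
    Num.min (compH P (x k) 0 i) `|pH (lam k) 0 i| @[k --> \oo] --> (0 : R) }.

End MPCC.

(* Main.v *)
Require Import Defs.
From HB Require Import structures.
From mathcomp Require Import all_boot all_order all_algebra.
From mathcomp Require Import all_classical all_reals all_analysis.
From mathcomp Require Import ring lra.
Import Order.TTheory GRing.Theory Num.Theory numFieldNormedType.Exports.

(** Both equivalences are instances of one statement about a sign test [phi]:
    a function of the pair [(a, b) = (lambda_G, lambda_H)_i] of multipliers
    whose nonnegativity is the sign condition of the stationarity concept
    ([phiAC_ge0], [phiAM_ge0P]), and whose negative part dominates
    [min (|a|, |b|)].  Hence the condition can be restored, at the cost
    [max (0, - phi a b)], by zeroing the multiplier of smaller modulus.  The
    statement is [sign_stationaryP].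

    An approximately W-stationary sequence satisfies the conditions of the
    theorem as it stands.  For a constraint [c >= 0] (with [c = - g, G, H])
    either the multiplier vanishes or [c = - delta], so the minimum of [c] and
    the modulus of the multiplier is bounded by [|delta|]
    ([normr_min_le_slack]).  At a biactive index the sign condition makes [phi]
    nonnegative; at any other index one of the two functions is positive at
    the limit point, its multiplier is eventually zero, and [phi] is
    nonnegative on the axes.

    In the other direction, which constraints may carry a multiplier is read
    off at the limit point [xb], and not at the iterates.  If [c xb = 0], the
    multiplier is kept and the relaxation is [delta = - c (x k)], so that the
    relaxed constraint is active; this tends to 0 by continuity.  If
    [c xb > 0], the multiplier tends to 0 because its minimum with [c (x k)]
    does, so it is replaced by 0.  As one of [G_i xb], [H_i xb] vanishes, the
    relaxed complementarity product vanishes for every [k].  Finally the pair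
    of multipliers of [G_i] and [H_i] is repaired as above: the lower limit of
    [phi] being nonnegative, this moves it by a null sequence.  Altogether the
    multipliers change by a null sequence, the gradients of the constraints
    converge along [x k], and the gradient of the Lagrangian is affine in the
    multipliers, so it still tends to 0 ([grad_Lcc_perturb]). *)

Set Implicit Arguments.
Unset Strict Implicit.
Unset Printing Implicit Defensive.

Local Open Scope classical_set_scope.
Local Open Scope ring_scope.

(** * Limits of rows, multipliers and real sequences *)

Lemma cvg_rowP (R : realType) (n : nat) (u : nat -> 'rV[R]_n) (l : 'rV[R]_n) :
  u k @[k --> \oo] --> l <-> forall j, u k 0 j @[k --> \oo] --> l 0 j.
Proof.
split=> [ul j|ul].
  exact: (cvg_comp u (fun v : 'rV[R]_n => v 0 j) ul
            (@coord_continuous R 1 n 0 j l)).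
apply/cvg_ballP => e e0; near=> k; split=> // i j; rewrite (ord1 i).
by move: j; near: k; apply: filter_forall => j; apply: cvg_ball (ul j) e e0.
Unshelve. all: by end_near. Qed.

Lemma cvg_mult0P (R : realType) (m p q : nat) (d : nat -> mult R m p q) :
  d k @[k --> \oo] --> (0 : mult R m p q) <->
  [/\ forall i, pg (d k) 0 i @[k --> \oo] --> (0 : R),
      forall i, ph (d k) 0 i @[k --> \oo] --> (0 : R),
      forall i, pG (d k) 0 i @[k --> \oo] --> (0 : R) &
      forall i, pH (d k) 0 i @[k --> \oo] --> (0 : R)].
Proof.
have rw r (u : nat -> 'rV[R]_r) : u k @[k --> \oo] --> (0 : 'rV[R]_r) <->
    forall j, u k 0 j @[k --> \oo] --> (0 : R).
  rewrite cvg_rowP; split=> ul j; first by have := ul j; rewrite mxE.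
  by rewrite mxE; exact: ul.
have proj (A B : topologicalType) (u : nat -> A * B) (a : A) (b : B) :
    u k @[k --> \oo] --> (a, b) ->
    (u k).1 @[k --> \oo] --> a /\ (u k).2 @[k --> \oo] --> b.
  by move=> uab; split;
    [exact: cvg_comp uab cvg_fst|exact: cvg_comp uab cvg_snd].
split=> [d0|[/rw dg /rw dh /rw dG /rw dH]].
  have [d1 dH] := proj _ _ d _ _ d0.
  have [d2 dG] := proj _ _ _ _ _ d1.
  have [dg dh] := proj _ _ _ _ _ d2.
  by split; apply/rw.
have -> : d = (fun k => (pg (d k), ph (d k), pG (d k), pH (d k))).
  by apply/funext => k; rewrite /pg /ph /pG /pH; case: (d k) => [[[]]].
exact: (cvg_pair (cvg_pair (cvg_pair dg dh) dG) dH).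
Qed.

Lemma limn_einfE (R : realType) (u : nat -> \bar R) :
  limn_einf u = ereal_sup (range (einfs u)).
Proof. by rewrite limn_einf_lim; apply/cvg_lim => //; exact: cvg_einfs_sup. Qed.

Lemma limn_einf_ge0 (R : realType) (u : nat -> R) :
  (\forall k \near \oo, 0 <= u k) ->
  (0 <= limn_einf (fun k => (u k)%:E))%E.
Proof.
move=> [N _ uN]; rewrite limn_einfE.
apply: (@le_trans _ _ (einfs (fun k => (u k)%:E) N)).
  by apply: le_ereal_inf_tmp => _ [k /= Nk <-]; rewrite lee_fin; exact: uN.
by apply: ereal_sup_ubound; exists N.
Qed.

(** A nonnegative lower limit forces the negative parts to vanish in the limit,
    which is the form in which the lower limit condition is used. *)
Lemma limn_einf_ge0_cvg (R : realType) (u : nat -> R) :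
  (0 <= limn_einf (fun k => (u k)%:E))%E ->
  Num.max 0 (- u k) @[k --> \oo] --> (0 : R).
Proof.
rewrite limn_einfE => u0.
apply/cvgr0Pnorm_lt => e e0.
have : ((- e)%:E < ereal_sup (range (einfs (fun k => (u k)%:E))))%E.
  by apply: lt_le_trans u0; rewrite lte_fin oppr_lt0.
move=> /ereal_sup_gt[_ [N _ <-] eN]; exists N => // k /= Nk.
have : (- e < u k)%R.
  by rewrite -lte_fin; apply: lt_le_trans eN _; apply: ereal_inf_lbound; exists k.
by move=> ?; rewrite ger0_norm ?le_max ?lexx// gt_max e0 ltrNl.
Qed.

Lemma cvg0_le_norm (R : realType) (u v : nat -> R) :
  (forall k, `|u k| <= `|v k|) -> v k @[k --> \oo] --> (0 : R) ->
  u k @[k --> \oo] --> (0 : R).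
Proof.
move=> uv /cvgr0Pnorm_lt v0; apply/cvgr0Pnorm_lt => e /v0.
by apply: filterS => k; exact: le_lt_trans.
Qed.

Lemma cvg0_sum (R : realType) (r : nat) (u : 'I_r -> nat -> R) :
  (forall i, u i k @[k --> \oo] --> (0 : R)) ->
  \sum_(i < r) u i k @[k --> \oo] --> (0 : R).
Proof.
move=> u0; rewrite (_ : (fun k => _) = \sum_(i < r) u i); last first.
  by apply/funext => k; rewrite fct_sumE.
elim/big_ind: _ => [|f g f0 g0|i _]; [exact: cvg_cst| |exact: u0].
by rewrite -[X in _ --> X]addr0; exact: cvgD f0 g0.
Qed.

(** * The gradient of the Lagrangian *)

Lemma is_derive_dot (R : realType) (n r : nat) (F : 'rV[R]_n -> 'rV[R]_r)
    (u : 'rV[R]_r) (x : 'rV[R]_n) j : C1_vec F ->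
  is_derive x (delta_mx 0 j) (fun y => dot u (F y))
    (\sum_(i < r) u 0 i * grad (fun y => F y 0 i) x 0 j).
Proof.
move=> F1; rewrite (_ : (fun y => _) = \sum_(i < r) (u 0 i \*: fun y => F y 0 i)).
  apply: is_derive_sum => i; apply: is_deriveZ.
  rewrite mxE; apply/derivableP/diff_derivable.
  by have [+ _] := F1 i.
by apply/funext => y; rewrite fct_sumE.
Qed.

Lemma grad_LccE (R : realType) (n m p q : nat) (P : mpcc R n m p q) x l j :
  grad_Lcc P x l 0 j =
    grad (obj P) x 0 j
    + (\sum_(i < m) pg l 0 i * grad (fun y => ineq P y 0 i) x 0 j)
    + (\sum_(i < p) ph l 0 i * grad (fun y => eqc P y 0 i) x 0 j)
    - (\sum_(i < q) pG l 0 i * grad (fun y => compG P y 0 i) x 0 j)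
    - (\sum_(i < q) pH l 0 i * grad (fun y => compH P y 0 i) x 0 j).
Proof.
have dg := is_derive_dot (pg l) x j (ineq_C1 P).
have dh := is_derive_dot (ph l) x j (eqc_C1 P).
have dG := is_derive_dot (pG l) x j (compG_C1 P).
have dH := is_derive_dot (pH l) x j (compH_C1 P).
have df : is_derive x (delta_mx 0 j) (obj P) (grad (obj P) x 0 j).
  rewrite mxE; apply/derivableP/diff_derivable.
  by have [+ _] := obj_C1 P.
have D := is_deriveB (is_deriveB (is_deriveD (is_deriveD df dg) dh) dG) dH.
by rewrite [LHS]mxE; exact: (@derive_val _ _ _ _ _ _ _ D).
Qed.

(** The gradients converge along [x k] by continuity, so they stay bounded, and
    null coefficients make their combination tend to zero. *)
Lemma cvg0_dot_grad (R : realType) (n r : nat) (F : 'rV[R]_n -> 'rV[R]_r)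
    (x : nat -> 'rV[R]_n) (xb : 'rV[R]_n) (w : nat -> 'rV[R]_r) j :
  C1_vec F -> x k @[k --> \oo] --> xb ->
  (forall i, w k 0 i @[k --> \oo] --> (0 : R)) ->
  \sum_(i < r) w k 0 i * grad (fun y => F y 0 i) (x k) 0 j
    @[k --> \oo] --> (0 : R).
Proof.
move=> F1 xxb w0.
apply: cvg0_sum => i.
have [_ /(_ xb) Gc] := F1 i.
have /cvg_rowP/(_ j) := cvg_comp x (grad (fun y => F y 0 i)) xxb Gc.
by rewrite -[X in _ -> _ --> X](mul0r (grad (fun y => F y 0 i) xb 0 j)); exact: cvgM.
Qed.

Lemma C1_cvg (R : realType) (n r : nat) (F : 'rV[R]_n -> 'rV[R]_r)
    (x : nat -> 'rV[R]_n) (xb : 'rV[R]_n) i :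
  C1_vec F -> x k @[k --> \oo] --> xb ->
  F (x k) 0 i @[k --> \oo] --> F xb 0 i.
Proof.
move=> F1 xxb; have [/(_ xb) /differentiable_continuous Fc _] := F1 i.
exact: (cvg_comp x (fun y => F y 0 i) xxb Fc).
Qed.

Lemma grad_LccD (R : realType) (n m p q : nat) (P : mpcc R n m p q) x l w j :
  grad_Lcc P x (l + w) 0 j =
    grad_Lcc P x l 0 j
    + (\sum_(i < m) pg w 0 i * grad (fun y => ineq P y 0 i) x 0 j)
    + (\sum_(i < p) ph w 0 i * grad (fun y => eqc P y 0 i) x 0 j)
    - (\sum_(i < q) pG w 0 i * grad (fun y => compG P y 0 i) x 0 j)
    - (\sum_(i < q) pH w 0 i * grad (fun y => compH P y 0 i) x 0 j).
Proof.
have split_sum r (c : 'I_r -> R) (v v' : 'rV[R]_r) :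
    \sum_(i < r) (v + v') 0 i * c i =
    \sum_(i < r) v 0 i * c i + \sum_(i < r) v' 0 i * c i.
  by rewrite -big_split /=; apply: eq_bigr => i _; rewrite mxE mulrDl.
by rewrite !grad_LccE !split_sum; ring.
Qed.

(** Stationarity in the limit is insensitive to null perturbations of the
    multipliers; the multipliers themselves may be unbounded. *)
Lemma grad_Lcc_perturb (R : realType) (n m p q : nat) (P : mpcc R n m p q)
    (xb : 'rV[R]_n) (x : nat -> 'rV[R]_n) (l l' : nat -> mult R m p q) :
  x k @[k --> \oo] --> xb ->
  l' k - l k @[k --> \oo] --> (0 : mult R m p q) ->
  grad_Lcc P (x k) (l k) @[k --> \oo] --> (0 : 'rV[R]_n) ->
  grad_Lcc P (x k) (l' k) @[k --> \oo] --> (0 : 'rV[R]_n).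
Proof.
move=> xxb /cvg_mult0P[wg wh wG wH] /cvg_rowP gl; apply/cvg_rowP => j.
have Sg := cvg0_dot_grad j (ineq_C1 P) xxb wg.
have Sh := cvg0_dot_grad j (eqc_C1 P) xxb wh.
have SG := cvg0_dot_grad j (compG_C1 P) xxb wG.
have SH := cvg0_dot_grad j (compH_C1 P) xxb wH.
have H := cvgB (cvgB (cvgD (cvgD (gl j) Sg) Sh) SG) SH.
rewrite mxE !(addr0, subr0) in H.
rewrite mxE; under eq_fun => k do rewrite -[l' k](subrK (l k)) addrC grad_LccD.
exact: H.
Qed.

(** * One relaxed constraint and its multiplier *)

(** Relaxed complementarity leaves two cases. If [a = 0], the minimum is the
    negative part of [c], bounded since [- d <= c]; otherwise [c = - d]. *)
Lemma normr_min_le_slack (R : realType) (c a d : R) :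
  - d <= c -> a * (c + d) = 0 -> `|Num.min c `|a| | <= `|d|.
Proof.
move=> dc /eqP; rewrite mulf_eq0 => /orP[/eqP->|/eqP cd].
  rewrite normr0; case: (leP c 0) => c0; last by rewrite normr0.
  by rewrite ler0_norm // (le_trans _ (ler_norm d)) // lerNl.
rewrite -(normrN d) (_ : - d = c); last by lra.
have [//|ac] := leP c `|a|.
by rewrite normr_id [leRHS]ger0_norm ?(ltW ac)// (le_trans _ (ltW ac)).
Qed.

(** Here [c] is the value of a constraint at an iterate and [c0] its value at the
    limit point. The relaxed constraint is active when [c0 = 0]; when [c0 > 0] only
    the violation of the constraint is relaxed. *)
Definition slack (R : realType) (c0 c : R) : R :=
  if c0 == 0 then - c else Num.max 0 (- c).

Definition keep (R : realType) (c0 a : R) : R := if c0 == 0 then a else 0.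

Lemma slack_ge (R : realType) (c0 c : R) : - slack c0 c <= c.
Proof. by rewrite /slack; case: eqP => _; rewrite ?opprK // lerNl le_max lexx orbT. Qed.

Lemma keep_slack0 (R : realType) (c0 c a : R) : keep c0 a * (c + slack c0 c) = 0.
Proof. by rewrite /keep /slack; case: eqP => _; rewrite ?subrr ?mulr0 ?mul0r. Qed.

Lemma cvg_slack (R : realType) (c : nat -> R) (c0 : R) : 0 <= c0 ->
  c k @[k --> \oo] --> c0 -> slack c0 (c k) @[k --> \oo] --> (0 : R).
Proof.
move=> c0_ge0 cc0; rewrite /slack; case: eqP => [c00|/eqP c0_neq0].
  by rewrite -oppr0; apply: cvgN; rewrite -[X in _ --> X]c00.
have c0_gt0 : 0 < c0 by rewrite lt_def c0_neq0.
apply/cvgr0Pnorm_lt => e e0; near=> k.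
rewrite max_l ?normr0 // oppr_le0; apply/ltW; near: k.
exact: (cvgr_gt c0 cc0).
Unshelve. all: by end_near. Qed.

(** When [c0 > 0] the values [c k] eventually stay above [c0 / 2], so the
    minimum with [c k] can only tend to zero through the multiplier. *)
Lemma cvg_keep (R : realType) (c a : nat -> R) (c0 : R) : 0 <= c0 ->
  c k @[k --> \oo] --> c0 -> Num.min (c k) `|a k| @[k --> \oo] --> (0 : R) ->
  keep c0 (a k) - a k @[k --> \oo] --> (0 : R).
Proof.
move=> c0_ge0 cc0 ca0; rewrite /keep; case: eqP => [c00|/eqP c0_neq0].
  by under eq_fun do rewrite subrr; exact: cvg_cst.
have c0_gt0 : 0 < c0 by rewrite lt_def c0_neq0.
have c0h : c0 / 2 < c0 by lra.
move/cvgr0Pnorm_lt : ca0 => ca0; apply/cvgr0Pnorm_lt => e e0.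
have m0 : 0 < Num.min e (c0 / 2) by rewrite lt_min e0 divr_gt0.
near=> k; rewrite sub0r normrN.
have ck : c0 / 2 < c k by near: k; exact: (cvgr_gt c0 cc0).
have : `|Num.min (c k) `|a k| | < Num.min e (c0 / 2) by near: k; exact: ca0.
rewrite ger0_norm; last by rewrite le_min normr_ge0 andbT; lra.
rewrite gt_min !lt_min => /orP[/andP[_]|/andP[]//].
by move=> /(lt_trans ck); rewrite ltxx.
Unshelve. all: by end_near. Qed.

(** * Sign tests for pairs of multipliers *)

(** The abstraction covering both stationarity concepts: a pair passes when its
    value is nonnegative, pairs on the axes pass, and the third condition says
    that the value of a failing pair bounds its distance to the axes. *)
Definition sign_test (R : realType) (phi : R -> R -> R) : Prop :=
  [/\ forall b, 0 <= phi 0 b, forall a, 0 <= phi a 0 &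
      forall a b, phi a b < 0 -> Num.min `|a| `|b| <= - phi a b].

(** A nearest pair on the axes, for a pair that fails the test. *)
Definition repair (R : realType) (phi : R -> R -> R) (a b : R) : R * R :=
  if 0 <= phi a b then (a, b) else if `|a| <= `|b| then (0, b) else (a, 0).

Lemma repair_ge0 (R : realType) (phi : R -> R -> R) (a b : R) :
  sign_test phi -> 0 <= phi (repair phi a b).1 (repair phi a b).2.
Proof. by case=> p0b pa0 _; rewrite /repair; case: ifP => //; case: ifP. Qed.

Lemma repair_mul0l (R : realType) (phi : R -> R -> R) (a b c : R) :
  a * c = 0 -> (repair phi a b).1 * c = 0.
Proof. by rewrite /repair; do 2 (case: ifP => //= _); rewrite mul0r. Qed.

Lemma repair_mul0r (R : realType) (phi : R -> R -> R) (a b c : R) :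
  b * c = 0 -> (repair phi a b).2 * c = 0.
Proof. by rewrite /repair; do 2 (case: ifP => //= _); rewrite mul0r. Qed.

(** A failing pair moves by [min (|a|, |b|)], which the sign test bounds. *)
Lemma repair_dist (R : realType) (phi : R -> R -> R) (a b : R) : sign_test phi ->
  `|(repair phi a b).1 - a| <= `|Num.max 0 (- phi a b)| /\
  `|(repair phi a b).2 - b| <= `|Num.max 0 (- phi a b)|.
Proof.
case=> _ _ phi_lt0; rewrite /repair.
have [_|phi0] := leP 0 (phi a b); first by rewrite !subrr normr0 !normr_ge0.
have := phi_lt0 a b phi0; rewrite max_r; last by rewrite oppr_ge0 ltW.
rewrite (ger0_norm (_ : 0 <= - phi a b)); last by rewrite oppr_ge0 ltW.
have [ab H|ab H] := leP `|a| `|b|; rewrite /= subrr normr0 sub0r normrN; split=> //.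
all: by rewrite oppr_ge0 ltW.
Qed.

(** * Stationarity with respect to a sign test *)

Definition sign_stationary (R : realType) (n m p q : nat) (phi : R -> R -> R)
    (P : mpcc R n m p q) (xb : 'rV[R]_n) : Prop :=
  exists x lam del eps, approx_W_stationary P xb x lam del eps /\
    forall i, i \in I00 P xb -> forall k,
      0 <= phi (pG (lam k) 0 i) (pH (lam k) 0 i).

(** A constraint that is positive in the limit ends up inactive even after the
    relaxation, so complementarity kills its multiplier. *)
Lemma cvg_multiplier0 (R : realType) (c a d : nat -> R) (c0 : R) : 0 < c0 ->
  c k @[k --> \oo] --> c0 -> d k @[k --> \oo] --> (0 : R) ->
  (forall k, a k * (c k + d k) = 0) -> \forall k \near \oo, a k = 0.
Proof.
move=> c0_gt0 cc0 d0 acd.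
have cd : c k + d k @[k --> \oo] --> c0 by rewrite -[c0]addr0; exact: cvgD.
near=> k; apply/eqP; have /eqP := acd k; rewrite mulf_eq0 => /orP[//|/eqP cd0].
suff : 0 < c k + d k by rewrite cd0 ltxx.
by near: k; exact: (cvgr_gt c0 cd).
Unshelve. all: by end_near. Qed.

(** The inner product has nonnegative terms, so its vanishing is componentwise. *)
Lemma feasible_compl (R : realType) (n m p q : nat) (P : mpcc R n m p q) xb i :
  feasible P xb -> compG P xb 0 i = 0 \/ compH P xb 0 i = 0.
Proof.
case=> _ _ G0 H0 /psumr_eq0P GH0.
have /eqP : compG P xb 0 i * compH P xb 0 i = 0.
  by apply: GH0 => // j _; rewrite mulr_ge0.
by rewrite mulf_eq0 => /orP[]/eqP; [left|right].
Qed.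

Lemma approx_W_stationary_star (R : realType) (n m p q : nat)
    (P : mpcc R n m p q) xb x lam del eps :
  approx_W_stationary P xb x lam del eps -> star_cond P xb x lam.
Proof.
case=> xxb /cvg_mult0P[dg _ dG dH] eps0 epsE Wg _ WG WH _; split=> //.
- by rewrite (_ : (fun k => _) = eps) //; apply/funext => k; rewrite epsE.
- by move=> k i; have [] := Wg k i.
- move=> i; apply: cvg0_le_norm (dg i) => k; have [lg0 gd ld] := Wg k i.
  rewrite -[pg (lam k) 0 i in X in X <= _]ger0_norm //.
  apply: normr_min_le_slack; first by rewrite lerN2.
  by rewrite addrC -opprB mulrN ld oppr0.
- by move=> i; apply: cvg0_le_norm (dG i) => k; have [] := WG k i;
    exact: normr_min_le_slack.
- by move=> i; apply: cvg0_le_norm (dH i) => k; have [] := WH k i;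
    exact: normr_min_le_slack.
Qed.

(** Off the biactive set one multiplier is eventually zero, and sign tests are
    nonnegative on the axes; so the lower limit condition holds at every index
    although the sign condition is imposed on the biactive ones only. *)
Lemma approx_W_stationary_einf (R : realType) (n m p q : nat)
    (phi : R -> R -> R) (P : mpcc R n m p q) xb x lam del eps :
  sign_test phi -> feasible P xb -> approx_W_stationary P xb x lam del eps ->
  (forall i, i \in I00 P xb -> forall k,
      0 <= phi (pG (lam k) 0 i) (pH (lam k) 0 i)) ->
  forall i, (0 <= limn_einf (fun k =>
    (phi (pG (lam k) 0 i) (pH (lam k) 0 i))%:E))%E.
Proof.
move=> [phi0b phia0 _] [_ _ G0 H0 _].
case=> xxb /cvg_mult0P[_ _ dG dH] _ _ _ _ WG WH _ phi_ge0 i.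
apply: limn_einf_ge0; have [iI|] := boolP (i \in I00 P xb).
  by apply: nearW => k; exact: phi_ge0.
rewrite inE negb_and => /orP[Gi|Hi].
- have G_gt0 : 0 < compG P xb 0 i by rewrite lt_def Gi G0.
  have := cvg_multiplier0 G_gt0
    (C1_cvg (i := i) (compG_C1 P) xxb) (dG i) (fun k => (WG k i).2).
  by apply: filterS => k ->.
- have H_gt0 : 0 < compH P xb 0 i by rewrite lt_def Hi H0.
  have := cvg_multiplier0 H_gt0
    (C1_cvg (i := i) (compH_C1 P) xxb) (dH i) (fun k => (WH k i).2).
  by apply: filterS => k ->.
Qed.

(** The construction of a W-stationary sequence on the same iterates: multipliers
    of constraints inactive at [xb] are dropped, pairs failing the sign test are
    repaired, and the relaxation is the one of [slack]. *)
Lemma star_sign_stationary (R : realType) (n m p q : nat)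
    (phi : R -> R -> R) (P : mpcc R n m p q) xb x lam :
  sign_test phi -> feasible P xb -> star_cond P xb x lam ->
  (forall i, (0 <= limn_einf (fun k =>
    (phi (pG (lam k) 0%R i) (pH (lam k) 0%R i))%:E))%E) ->
  sign_stationary phi P xb.
Proof.
move=> phiP feas [xxb gL0 lg_ge0 ming minG minH] einf.
have [g_le0 h0 G0 H0 _] := feas.
have gc i := C1_cvg (i := i) (ineq_C1 P) xxb.
have hc i := C1_cvg (i := i) (eqc_C1 P) xxb.
have Gc i := C1_cvg (i := i) (compG_C1 P) xxb.
have Hc i := C1_cvg (i := i) (compH_C1 P) xxb.
pose g0 i := - ineq P xb 0 i.
pose G0_ i := compG P xb 0 i.
pose H0_ i := compH P xb 0 i.
pose kG k i := keep (G0_ i) (pG (lam k) 0 i).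
pose kH k i := keep (H0_ i) (pH (lam k) 0 i).
pose lam' k : mult R m p q :=
  (\row_i keep (g0 i) (pg (lam k) 0 i), ph (lam k),
   \row_i (repair phi (kG k i) (kH k i)).1,
   \row_i (repair phi (kG k i) (kH k i)).2).
pose del k : mult R m p q :=
  (\row_i slack (g0 i) (- ineq P (x k) 0 i), eqc P (x k),
   \row_i slack (G0_ i) (compG P (x k) 0 i),
   \row_i slack (H0_ i) (compH P (x k) 0 i)).
have g0_ge0 i : 0 <= g0 i by rewrite oppr_ge0.
(* At a biactive index this is the lower limit hypothesis; elsewhere a
   multiplier was dropped, and the sign test is nonnegative on the axes. *)
have phik i : Num.max 0 (- phi (kG k i) (kH k i)) @[k --> \oo] --> (0 : R).
  have [phi0b phia0 _] := phiP; have := limn_einf_ge0_cvg (einf i).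
  rewrite /kG /kH /keep; case: eqP => _; case: eqP => _ // _;
    by under eq_fun do rewrite max_l ?oppr_le0 //; exact: cvg_cst.
have lam'c : lam' k - lam k @[k --> \oo] --> (0 : mult R m p q).
  apply/cvg_mult0P; split=> i.
  - under eq_fun do rewrite /lam' /pg /= !mxE.
    apply: (cvg_keep (g0_ge0 i) (cvgN (gc i))).
    by under eq_fun do rewrite (ger0_norm (lg_ge0 _ _)); exact: ming.
  - by under eq_fun do rewrite /lam' /ph /= !mxE subrr; exact: cvg_cst.
  - have D : (repair phi (kG k i) (kH k i)).1 - kG k i @[k --> \oo] --> (0 : R).
      by apply: cvg0_le_norm (phik i) => k; have [] := repair_dist (kG k i) (kH k i) phiP.
    have E : (fun k => pG (lam' k - lam k) 0 i) =
        (fun k => ((repair phi (kG k i) (kH k i)).1 - kG k i)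
                  + (kG k i - pG (lam k) 0 i)).
      by apply/funext => k; rewrite subrKA /pG !mxE.
    rewrite E; have := cvgD D (cvg_keep (G0 i) (Gc i) (minG i)).
    by rewrite addr0; exact.
  - have D : (repair phi (kG k i) (kH k i)).2 - kH k i @[k --> \oo] --> (0 : R).
      by apply: cvg0_le_norm (phik i) => k; have [] := repair_dist (kG k i) (kH k i) phiP.
    have E : (fun k => pH (lam' k - lam k) 0 i) =
        (fun k => ((repair phi (kG k i) (kH k i)).2 - kH k i)
                  + (kH k i - pH (lam k) 0 i)).
      by apply/funext => k; rewrite subrKA /pH !mxE.
    rewrite E; have := cvgD D (cvg_keep (H0 i) (Hc i) (minH i)).
    by rewrite addr0; exact.
exists x, lam', del, (fun k => grad_Lcc P (x k) (lam' k)); split; last first.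
  by move=> i _ k; rewrite /pG /pH !mxE; exact: repair_ge0.
split=> //.
- apply/cvg_mult0P; split=> i.
  + under eq_fun do rewrite /del /pg /= !mxE.
    exact: (cvg_slack (g0_ge0 i) (cvgN (gc i))).
  + by have := hc i; rewrite h0 mxE.
  + under eq_fun do rewrite /del /pG /= !mxE.
    exact: (cvg_slack (G0 i) (Gc i)).
  + under eq_fun do rewrite /del /pH /= !mxE.
    exact: (cvg_slack (H0 i) (Hc i)).
- exact: grad_Lcc_perturb xxb lam'c gL0.
- move=> k i; rewrite /pg !mxE; split.
  + by rewrite /keep; case: ifP => // _; exact: lg_ge0.
  + by have := slack_ge (g0 i) (- ineq P (x k) 0 i); lra.
  + have := keep_slack0 (g0 i) (- ineq P (x k) 0 i) (pg (lam k) 0 i).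
    by rewrite /pg; lra.
- move=> k i; rewrite /pG !mxE; split; first exact: slack_ge.
  by apply: repair_mul0l; exact: keep_slack0.
- move=> k i; rewrite /pH !mxE; split; first exact: slack_ge.
  by apply: repair_mul0r; exact: keep_slack0.
- move=> k i; rewrite /pG /pH !mxE /slack /G0_ /H0_.
  by case: (feasible_compl i feas) => ->;
    rewrite eqxx subrr ?mul0r ?mulr0.
Qed.

Lemma sign_stationaryP (R : realType) (n m p q : nat)
    (phi : R -> R -> R) (P : mpcc R n m p q) xb :
  sign_test phi -> feasible P xb ->
  sign_stationary phi P xb <->
  exists x lam, star_cond P xb x lam /\
    forall i, (0 <= limn_einf (fun k =>
      (phi (pG (lam k) 0%R i) (pH (lam k) 0%R i))%:E))%E.
Proof.
move=> phiP feas; split=> [[x [lam [del [eps [W phi_ge0]]]]]|[x [lam [S einf]]]].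
  exists x, lam; split; first exact: approx_W_stationary_star W.
  exact: approx_W_stationary_einf phiP feas W phi_ge0.
exact: star_sign_stationary phiP feas S einf.
Qed.

(** * The two sign tests *)

Definition phiAC (R : realType) (a b : R) : R :=
  Num.min (Num.max a (- b)) (Num.max (- a) b).

Definition phiAM (R : realType) (a b : R) : R :=
  Num.min (phiAC a b) (Num.max a b).

Lemma phiAC_ge0 (R : realType) (a b : R) : (0 <= phiAC a b) = (0 <= a * b).
Proof.
rewrite /phiAC le_min !le_max !oppr_ge0.
by case: (ltrgt0P a) => [a0|a0|->]; case: (ltrgt0P b) => [b0|b0|->];
  rewrite ?mulr0 ?mul0r ?lexx //=; apply/esym; nra.
Qed.

(** A negative value comes from one of the two maxima, that is from [a] and [b] of
    opposite signs; that maximum is then [- min (|a|, |b|)]. *)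
Lemma phiAC_sign_test (R : realType) : sign_test (@phiAC R).
Proof.
split=> [b|a|a b]; rewrite ?phiAC_ge0 ?mul0r ?mulr0 // /phiAC.
rewrite gt_min !gt_max !oppr_lt0 => /orP[]/andP[a0 b0].
- rewrite (ltr0_norm a0) (gtr0_norm b0) lerNr oppr_min opprK.
  by rewrite ge_min lexx.
- rewrite (gtr0_norm a0) (ltr0_norm b0) lerNr oppr_min opprK.
  by rewrite ge_min lexx orbT.
Qed.

Lemma phiAM_ge0P (R : realType) (a b : R) :
  0 <= phiAM a b <-> 0 < Num.min a b \/ a * b = 0.
Proof.
rewrite /phiAM le_min phiAC_ge0 le_max lt_min.
split=> [/andP[ab0 /orP ab]|[/andP[a0 b0]|ab0]].
- have [->|a_neq0] := eqVneq a 0; first by right; rewrite mul0r.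
  have [->|b_neq0] := eqVneq b 0; first by right; rewrite mulr0.
  have ab_gt0 : 0 < a * b by rewrite lt_def mulf_neq0.
  by left; case: ab => [a0|b0]; apply/andP; split; nra.
- by rewrite ltW ?mulr_gt0 // ltW.
- rewrite ab0 lexx /=.
  by move/eqP : ab0; rewrite mulf_eq0 => /orP[]/eqP ->; rewrite lexx ?orbT.
Qed.

(** The additional maximum only rejects pairs with [a < 0] and [b < 0], where it
    equals [- min (|a|, |b|)] as well. *)
Lemma phiAM_sign_test (R : realType) : sign_test (@phiAM R).
Proof.
split=> [b|a|a b].
- by apply/phiAM_ge0P; right; rewrite mul0r.
- by apply/phiAM_ge0P; right; rewrite mulr0.
have [_ _ phiAC_lt0] := phiAC_sign_test R.
rewrite /phiAM gt_min => /orP[/phiAC_lt0 H|].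
  by apply: (le_trans H); rewrite lerN2 ge_min lexx.
rewrite gt_max => /andP[a0 b0].
by rewrite (ltr0_norm a0) (ltr0_norm b0) lerNr oppr_min !opprK ge_min lexx orbT.
Qed.

Unset Implicit Arguments.

Theorem lemma5p5 (R : realType) (n m p q : nat) (hq : (1 <= q)%N)
    (P : mpcc R n m p q) (xb : 'rV[R]_n) (hxb : feasible P xb) :
  (AC_stationary P xb <->
   exists (x : nat -> 'rV[R]_n) (lam : nat -> mult R m p q),
     star_cond P xb x lam /\
     forall i : 'I_q,
       (0 <= limn_einf (fun k : nat =>
          (Num.min (Num.max (pG (lam k) 0%R i) (- pH (lam k) 0%R i))
                   (Num.max (- pG (lam k) 0%R i) (pH (lam k) 0%R i)))%R%:E))%E)
  /\
  (AM_stationary P xb <->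
   exists (x : nat -> 'rV[R]_n) (lam : nat -> mult R m p q),
     star_cond P xb x lam /\
     forall i : 'I_q,
       (0 <= limn_einf (fun k : nat =>
          (Num.min (Num.min
                   (Num.max (pG (lam k) 0%R i) (- pH (lam k) 0%R i))
                   (Num.max (- pG (lam k) 0%R i) (pH (lam k) 0%R i)))
                   (Num.max (pG (lam k) 0%R i) (pH (lam k) 0%R i)))%R%:E))%E).
Proof.
split.
- apply: iff_trans (sign_stationaryP (@phiAC_sign_test R) hxb).
  by split=> -[x [lam [del [eps [W s]]]]]; exists x, lam, del, eps;
    split=> // i iI k; have := s i iI k; rewrite phiAC_ge0.
- apply: iff_trans (sign_stationaryP (@phiAM_sign_test R) hxb).
  by split=> -[x [lam [del [eps [W s]]]]]; exists x, lam, del, eps;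
    split=> // i iI k; have := s i iI k; rewrite phiAM_ge0P.
Qed.
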